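(* Let $A,B\in\mathbb{C}_{n,n}$. Then $A\mathop{\le}\limits^{\mathrm{CE}}B$ if and only if there exists a unitary matrix $\widehat{U}$ satisfying $$A=\widehat{U}\begin{bmatrix}T&\widehat{S}_1&\widehat{S}_2\\0&0&0\\0&0&N_{22}\end{bmatrix}\widehat{U}^\ast,\qquad B=\widehat{U}\begin{bmatrix}T&\widehat{S}_1-T^{-1}\widehat{S}_1T_1&\widehat{S}_2-T^{-1}\widehat{S}_1S_1\\0&T_1&S_1\\0&0&N_2\end{bmatrix}\widehat{U}^\ast,$$ where $T$ and $T_1$ are invertible, $N_{22}$ and $N_2$ are nilpotent, and $N_{22}\mathop{\le}\limits^{-}N_2$.
   Context: $\mathbb{C}_{n,n}$ is the set of complex $n\times n$ matrices and $A^\ast$ the conjugate transpose. The block partitions are conformal with square diagonal blocks (blocks may be empty); $\widehat{S}_1,\widehat{S}_2,S_1$ are otherwise arbitrary matrices of appropriate size. The index $\mathrm{Ind}(A)$ is the smallest positive integer $k$ with $\mathrm{rk}(A^{k+1})=\mathrm{rk}(A^k)$. Core-EP decomposition (known): every $A\in\mathbb{C}_{n,n}$ with $\mathrm{Ind}(A)=k$ can be written uniquely as $A=A_1+A_2$ with $\mathrm{Ind}(A_1)=1$, $A_2^k=0$ and $A_1^\ast A_2=A_2A_1=0$ (one or both may be null). For a matrix $M$ of index one, the group inverse $M^\#$ is the unique $X$ with $XM^2=M$, $XMX=X$, $MX=XM$. The sharp partial order on matrices of index one: $M\mathop{\le}\limits^{\#}M'$ means $MM^\#=M'M^\#$ and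 $M^\#M=M^\#M'$. The minus partial order: $M\mathop{\le}\limits^{-}M'$ means $\mathrm{rk}(M'-M)=\mathrm{rk}(M')-\mathrm{rk}(M)$. The C-E order: $A\mathop{\le}\limits^{\mathrm{CE}}B$ means $A_1\mathop{\le}\limits^{\#}B_1$ and $A_2\mathop{\le}\limits^{-}B_2$, where $A=A_1+A_2$ and $B=B_1+B_2$ are the core-EP decompositions. *)

(* Defs.v *)
From HB Require Import structures.
From mathcomp Require Import all_boot all_order all_algebra.
From mathcomp Require Import spectral.
From mathcomp Require Import reals complex.

Set Implicit Arguments.
Unset Strict Implicit.
Unset Printing Implicit Defensive.

Import Order.TTheory GRing.Theory Num.Theory.
Local Open Scope ring_scope.
Local Open Scope sesquilinear_scope.

Section CEOrder.
Variables (C : numClosedFieldType) (n : nat).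
Implicit Types A B M X : 'M[C]_n.

Lemma ex_Ind A :
  exists k : nat, (0 < k)%N && (\rank (A ^+ k.+1) == \rank (A ^+ k)).
Proof.
suff H r : forall k, (\rank (A ^+ k.+1) <= r)%N ->
    exists j : nat, (0 < j)%N && (\rank (A ^+ j.+1) == \rank (A ^+ j)).
  exact: (H _ 0%N (leqnn _)).
elim: r => [|r IHr] k hk; have hle : (\rank (A ^+ k.+2) <= \rank (A ^+ k.+1))%N
    by rewrite exprS mxrankM_maxr.
  by exists k.+1; rewrite eqn_leq hle (leq_trans hk).
have [e|ne] := eqVneq (\rank (A ^+ k.+2)) (\rank (A ^+ k.+1)).
  by exists k.+1; rewrite e eqxx.
by apply: (IHr k.+1); rewrite -ltnS (leq_trans _ hk)// ltn_neqAle ne.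
Qed.

(* Ind(A) is at least 1, also when A is invertible. *)
Definition Ind A : nat := ex_minn (ex_Ind A).

Definition nilpotent_mx A : Prop := exists k : nat, A ^+ k = 0.

(* The core-EP decomposition A = A1 + A2; the pair (A1, A2) exists and is
   unique for every A, so quantifying existentially over it in [CE_le] is
   the same as naming it. *)
Definition core_EP A (A1 A2 : 'M[C]_n) : Prop :=
  [/\ A = A1 + A2, Ind A1 = 1%N, A2 ^+ Ind A = 0,
      A1 ^t* *m A2 = 0 & A2 *m A1 = 0].

Definition group_inverse M X : Prop :=
  [/\ X *m M ^+ 2 = M, X *m M *m X = X & M *m X = X *m M].

(* The sharp order on matrices of index one, for which the group inverse
   exists and is unique. *)
Definition sharp_le M M' : Prop :=
  [/\ Ind M = 1%N, Ind M' = 1%N &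
      exists X, [/\ group_inverse M X, M *m X = M' *m X & X *m M = X *m M']].

(* The ranks are compared in int, as subtraction on nat is truncated. *)
Definition minus_le M M' : Prop :=
  (\rank (M' - M))%:Z = (\rank M')%:Z - (\rank M)%:Z.

Definition CE_le A B : Prop :=
  exists A1 A2 B1 B2 : 'M[C]_n,
    [/\ core_EP A A1 A2, core_EP B B1 B2, sharp_le A1 B1 & minus_le A2 B2].

End CEOrder.

Definition block3_mx (C : pzRingType) (p q r : nat)
    (X11 : 'M[C]_p)      (X12 : 'M[C]_(p, q)) (X13 : 'M[C]_(p, r))
    (X21 : 'M[C]_(q, p)) (X22 : 'M[C]_q)      (X23 : 'M[C]_(q, r))
    (X31 : 'M[C]_(r, p)) (X32 : 'M[C]_(r, q)) (X33 : 'M[C]_r) :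
    'M[C]_(p + (q + r)) :=
  block_mx X11 (row_mx X12 X13)
           (col_mx X21 X31) (block_mx X22 X23 X32 X33).

(* Main.v *)
Require Import Defs.
From mathcomp Require Import all_boot all_order all_algebra.
From mathcomp Require Import spectral.
From mathcomp Require Import reals complex.

Set Implicit Arguments.
Unset Strict Implicit.
Unset Printing Implicit Defensive.

Import Order.TTheory GRing.Theory Num.Theory.
Local Open Scope ring_scope.
Local Open Scope sesquilinear_scope.
Local Open Scope complex_scope.

(** The idea is to put all four parts of the two core-EP decompositions into
    block form in one orthonormal basis, adapted to the ranges of the parts of
    index one.

    Left to right.  Let A = A1 + A2 and B = B1 + B2 be the decompositions and
    G the group inverse of A1.  The sharp order gives B1 A1 = A1^2 = A1 B1 and
    A1 = B1 G A1, so the range of A1 lies in that of B1 and there is an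
    orthonormal basis of the whole space that begins with a basis of the range
    of A1, continued to a basis of the range of B1 ([unitary_range_flag]).  In this basis only the first block row of A1 and
    the first two block rows of B1 survive.  That A1 and B1 have index one
    makes the diagonal blocks T and T1 invertible, B1 A1 = A1^2 makes
    the block of B1 below T vanish, and the first row of A1 B1 = A1^2, solved for the
    first row of B1, is the formula of the theorem ([sharp_le_block_rows]).
    The two equations B1^* B2 = 0 and B2 B1 = 0 leave only the last diagonal
    block of B2 ([orth_ker_corner]), and the minus order factors A2
    through B2 on both sides ([minus_le_mul]), so A2 has the same shape.

    Right to left.  The first block rows, completed by zeros, and the last
    diagonal block are the two summands.  All conditions are block
    computations ([sharp_le_blocks]) except the vanishing of A2^k for
    k = Ind A, where only nilpotency of A2 is given; this is the content of
    [core_EPI]. *)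

(** * Matrices over a field *)

(** Multiplying by B on the right can only shrink the column space of A, so
    equal ranks force equal column spaces. *)
Lemma mulmx_rank_eq (F : fieldType) m n p (A : 'M[F]_(m, n)) (B : 'M_(n, p)) :
  \rank (A *m B) = \rank A -> exists Z, A = A *m B *m Z.
Proof.
move=> rAB; have sub : ((A *m B)^T <= A^T)%MS by rewrite trmx_mul submxMl.
have [_] := mxrank_leqif_eq sub; rewrite !mxrank_tr rAB eqxx => /esym/andP[_].
move=> /submxP[Z /(congr1 trmx)]; rewrite trmx_mul !trmxK => eA.
by exists Z^T.
Qed.

(** A right inverse W of X makes V W a right inverse of the square matrix T. *)
Lemma row_free_mull_unit (F : fieldType) m n (T : 'M[F]_m) (X : 'M_(m, n)) V :
  row_free X -> T *m V = X -> T \in unitmx.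
Proof.
case/row_freeP=> W XW TV; apply: (mulmx1_unit (B := V *m W) _).1.
by rewrite mulmxA TV.
Qed.

Lemma unitarymxV (C : numClosedFieldType) n (U : 'M[C]_n) :
  U \is unitarymx -> U^t* *m U = 1%:M.
Proof. by move=> /unitarymxP /mulmx1C. Qed.

(** The rows of M^* are orthogonal to themselves, and the form is definite. *)
Lemma adj_mul_eq0 (C : numClosedFieldType) m n (M : 'M[C]_(m, n)) :
  M^t* *m M = 0 -> M = 0.
Proof.
move=> h; have /orthomx1P/orthomx_disj dis : M^t* *m M^t*^t* = 0.
  by rewrite trmxCK.
have : (M^t* <= M^t* :&: M^t*)%MS by rewrite sub_capmx submx_refl.
by rewrite dis submx0 => /eqP e; rewrite -[M]trmxCK e trmx0 map_mx0.
Qed.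

(** * Index, and sums of an index-one and a nilpotent matrix *)

Section Index.
Variables (C : numClosedFieldType) (n : nat).
Implicit Types A X : 'M[C]_n.

Lemma IndP A : [/\ (0 < Ind A)%N, \rank (A ^+ (Ind A).+1) = \rank (A ^+ Ind A)
  & forall k, (0 < k)%N -> \rank (A ^+ k.+1) = \rank (A ^+ k) ->
      (Ind A <= k)%N].
Proof.
rewrite /Ind; case: ex_minnP => m /andP[m0 /eqP rm] hm; split=> // k k0 rk.
by apply: hm; rewrite k0 rk eqxx.
Qed.

Lemma Ind1_mulr A : Ind A = 1%N -> exists X, A = A *m A *m X.
Proof.
case: (IndP A) => _ + _ => /[swap] ->; rewrite expr1 expr2 -mulmxE.
exact: mulmx_rank_eq.
Qed.

Lemma mull_Ind1 A X : X *m (A *m A) = A -> Ind A = 1%N.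
Proof.
move=> eA; have [Ipos _ hmin] := IndP A.
apply/eqP; rewrite eqn_leq Ipos andbT hmin // expr1 expr2 -mulmxE.
by apply/eqP; rewrite eqn_leq mxrankM_maxl -{1}eA mxrankM_maxr.
Qed.

(** The nilpotency index of A2 does not exceed k = Ind (A1 + A2).  The powers
    of A = A1 + A2 and of A2 differ by columns in the range of A1, because
    A2 A1 = 0.  Past the exponent k the column space of A^k is stationary, so
    it equals that of A^(m + k), where A2^(m + k) = 0, and lies in the range of
    A1.  Then so does A2^k, whose columns are also orthogonal to that range. *)
Lemma core_EPI A1 A2 : Ind A1 = 1%N -> nilpotent_mx A2 ->
  A1^t* *m A2 = 0 -> A2 *m A1 = 0 -> core_EP (A1 + A2) A1 A2.
Proof.
move=> i1 [m nil] orth ann; split=> //; set A := A1 + A2.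
have [kpos rk _] := IndP A; set k := Ind A in kpos rk *.
have pw j : exists Z, A ^+ j.+1 = A1 *m Z + A2 ^+ j.+1.
  elim: j => [|j [Z IH]]; first by exists 1%:M; rewrite !expr1 mulmx1.
  exists (A ^+ j.+1); rewrite [in LHS]exprS -mulmxE {1}/A mulmxDl.
  congr (_ + _).
  by rewrite IH mulmxDr mulmxA ann mul0mx add0r mulmxE -exprS.
have stab j : exists Y, A ^+ k = A ^+ (j + k) *m Y.
  elim: j => [|j [Y IH]]; first by exists 1%:M; rewrite mulmx1.
  move: rk; rewrite exprSr -mulmxE => /mulmx_rank_eq[Z eZ].
  exists (Z *m Y); rewrite {1}IH exprD {1}eZ -!mulmxE !mulmxA.
  by congr (_ *m _ *m _); rewrite !mulmxE -!exprD -exprSr.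
have [k' kE] : exists k', k = k'.+1 by case: (k) kpos => // k' _; exists k'.
have [Z0 eZ0] := pw k'; have [Y eY] := stab m; have [Z1 eZ1] := pw (m + k')%N.
have eN : A2 ^+ k = A1 *m (Z1 *m Y - Z0).
  rewrite mulmxBr mulmxA; apply/eqP; rewrite eq_sym subr_eq addrC kE -eZ0 -kE.
  by rewrite eY kE addnS eZ1 -addnS exprD nil mul0r addr0.
apply: adj_mul_eq0; rewrite {2}eN kE exprS -mulmxE trmx_mul map_mxM.
have orth' : A2^t* *m A1 = 0.
  by rewrite -[A1]trmxCK -map_mxM -trmx_mul orth trmx0 map_mx0.
by rewrite !mulmxA -[_ *m _ *m A1]mulmxA orth' mulmx0 mul0mx.
Qed.

End Index.

(** * Invariance under unitary similarity *)

Section Conjugation.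
Variables (C : numClosedFieldType) (n : nat).
Implicit Types A B M X U : 'M[C]_n.

(** The product is spelled as in the block forms to be reached, hence the
    adjoint instead of the inverse of U. *)
Definition uconj U M := U *m M *m U^t*.

Lemma uconjM U A B :
  U \is unitarymx -> uconj U A *m uconj U B = uconj U (A *m B).
Proof.
move=> uU; rewrite /uconj !mulmxA; congr (_ *m _ *m _).
by rewrite -!mulmxA unitarymxV // mulmx1.
Qed.

Lemma uconjD U A B : uconj U (A + B) = uconj U A + uconj U B.
Proof. by rewrite /uconj mulmxDr mulmxDl. Qed.

Lemma uconjB U A B : uconj U (A - B) = uconj U A - uconj U B.
Proof. by rewrite /uconj mulmxBr mulmxBl. Qed.

Lemma uconj0 U : uconj U 0 = 0.
Proof. by rewrite /uconj mulmx0 mul0mx. Qed.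

Lemma uconjX U A k : U \is unitarymx -> uconj U A ^+ k = uconj U (A ^+ k).
Proof.
move=> uU; elim: k => [|k IHk]; last by rewrite !exprS IHk -!mulmxE uconjM.
by rewrite !expr0 /uconj mulmx1; apply/esym/unitarymxP.
Qed.

Lemma uconj_adj U A : (uconj U A)^t* = uconj U (A^t*).
Proof. by rewrite /uconj !trmx_mul !map_mxM trmxCK mulmxA. Qed.

Lemma uconjK U A : U \is unitarymx -> uconj (U^t*) (uconj U A) = A.
Proof.
move=> uU; rewrite /uconj trmxCK !mulmxA unitarymxV // mul1mx.
by rewrite -mulmxA unitarymxV // mulmx1.
Qed.

Lemma uconjVK U A : U \is unitarymx -> uconj U (uconj (U^t*) A) = A.
Proof.
by move=> uU; rewrite -{1}(trmxCK U) uconjK // trmxC_unitary.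
Qed.

Lemma rank_uconj U A : U \is unitarymx -> \rank (uconj U A) = \rank A.
Proof.
move=> uU; rewrite /uconj mxrankMfree ?row_free_unit; last first.
  by rewrite unitarymx_unit ?trmxC_unitary.
by rewrite eqmxMfull // row_full_unit unitarymx_unit.
Qed.

Lemma Ind_uconj U A : U \is unitarymx -> Ind (uconj U A) = Ind A.
Proof.
move=> uU; apply: eq_ex_minn => k.
by rewrite !uconjX // !rank_uconj.
Qed.

Lemma core_EP_uconj U A A1 A2 : U \is unitarymx ->
  core_EP A A1 A2 -> core_EP (uconj U A) (uconj U A1) (uconj U A2).
Proof.
move=> uU [-> i1 n2 o1 o2]; split; first by rewrite uconjD.
- by rewrite Ind_uconj.
- by rewrite Ind_uconj // uconjX // n2 uconj0.
- by rewrite uconj_adj uconjM // o1 uconj0.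
- by rewrite uconjM // o2 uconj0.
Qed.

Lemma sharp_le_uconj U A B : U \is unitarymx ->
  sharp_le A B -> sharp_le (uconj U A) (uconj U B).
Proof.
move=> uU [iA iB [X [[e1 e2 e3] e4 e5]]]; split; rewrite ?Ind_uconj //.
exists (uconj U X); rewrite /group_inverse !uconjX // !uconjM //.
by rewrite e1 e2 -e5 -e4 e3.
Qed.

Lemma minus_le_uconj U A B : U \is unitarymx ->
  minus_le A B -> minus_le (uconj U A) (uconj U B).
Proof. by move=> uU; rewrite /minus_le -uconjB !rank_uconj. Qed.

Lemma CE_le_uconj U A B : U \is unitarymx ->
  CE_le A B -> CE_le (uconj U A) (uconj U B).
Proof.
move=> uU [A1 [A2 [B1 [B2 [cA cB s m]]]]].
exists (uconj U A1), (uconj U A2), (uconj U B1), (uconj U B2); split.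
- exact: core_EP_uconj.
- exact: core_EP_uconj.
- exact: sharp_le_uconj.
- exact: minus_le_uconj.
Qed.

End Conjugation.

(** * The minus order *)

Section MinusOrder.
Variables (C : numClosedFieldType) (n : nat).
Implicit Types M N : 'M[C]_n.

Lemma minus_leP M N :
  minus_le M N <-> (\rank (N - M)%R + \rank M)%N = \rank N.
Proof.
rewrite /minus_le; split=> [/eqP|<-]; last by rewrite PoszD addrK.
by rewrite eq_sym subr_eq -PoszD => /eqP[->].
Qed.

(** Rank is subadditive: N = (N - M) + M always has its row space inside the
    sum of the row spaces of N - M and M, and additivity of the ranks leaves no
    room for that sum to be larger. *)
Lemma minus_le_submx M N : minus_le M N -> (M <= N)%MS.
Proof.
move=> /minus_leP rk.
have sub : (N <= (N - M)%R + M)%MS.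
  by rewrite -{1}[N](subrK M) addmx_sub_adds.
have [rle] := mxrank_leqif_sup sub.
have -> : \rank N == \rank ((N - M)%R + M)%MS.
  by rewrite eqn_leq rle -rk; case: (mxrank_adds_leqif (N - M) M).
by move=> /esym; rewrite addsmx_sub => /andP[].
Qed.

Lemma minus_le_tr M N : minus_le M N -> minus_le M^T N^T.
Proof. by rewrite /minus_le -raddfB !mxrank_tr. Qed.

Lemma minus_le_mul M N : minus_le M N ->
  (exists G, M = G *m N) /\ (exists G, M = N *m G).
Proof.
move=> MN; split; first exact/submxP/minus_le_submx.
have /submxP[G /(congr1 trmx)] := minus_le_submx (minus_le_tr MN).
by rewrite trmx_mul !trmxK => ->; exists G^T.
Qed.
End MinusOrder.

(** * Matrices supported on the last diagonal block *)

Section Corner.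
Variables (C : numClosedFieldType) (p q r : nat).

Definition corner (N : 'M[C]_r) : 'M[C]_(p + (q + r)) :=
  block3_mx 0 0 0 0 0 0 0 0 N.

Lemma cornerE N : corner N = block_mx 0 0 0 (block_mx 0 0 0 N).
Proof. by rewrite /corner /block3_mx row_mx0 col_mx0. Qed.

Lemma cornerM M N : corner M *m corner N = corner (M *m N).
Proof.
by rewrite !cornerE !mulmx_block !(mul0mx, mulmx0, add0r, addr0).
Qed.

Lemma cornerX N k : corner N ^+ k.+1 = corner (N ^+ k.+1).
Proof.
elim: k => [|k IHk]; first by rewrite !expr1.
by rewrite exprS IHk -mulmxE cornerM mulmxE -exprS.
Qed.

Lemma cornerB M N : corner M - corner N = corner (M - N).
Proof.
by rewrite !cornerE opp_block_mx add_block_mx !(oppr0, addr0) opp_block_mx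
  add_block_mx !(oppr0, addr0).
Qed.

Lemma rank_corner N : \rank (corner N) = \rank N.
Proof. by rewrite cornerE !rank_diag_block_mx !mxrank0. Qed.

Lemma corner_inj : injective corner.
Proof.
by move=> M N; rewrite !cornerE => /eq_block_mx[_ _ _ /eq_block_mx[]].
Qed.

Lemma corner0 : corner 0 = 0.
Proof. by rewrite cornerE !block_mx0. Qed.

Lemma nilpotent_corner N : nilpotent_mx (corner N) <-> nilpotent_mx N.
Proof.
split=> -[k Nk].
  have : corner N ^+ k.+1 = 0 by rewrite exprS Nk mulr0.
  by rewrite cornerX -corner0 => /corner_inj Nk1; exists k.+1.
by exists k.+1; rewrite cornerX exprS Nk mulr0 corner0.
Qed.

Lemma minus_le_corner M N : minus_le (corner M) (corner N) <-> minus_le M N.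
Proof. by rewrite /minus_le cornerB !rank_corner. Qed.

Lemma corner1_mul m (u : 'M_(p, m)) (v : 'M_(q, m)) (w : 'M_(r, m)) :
  corner 1%:M *m col_mx u (col_mx v w) = col_mx 0 (col_mx 0 w).
Proof.
by rewrite cornerE !mul_block_col !(mul0mx, add0r, addr0, mul1mx).
Qed.

Lemma mul_corner1 m (u : 'M_(m, p)) (v : 'M_(m, q)) (w : 'M_(m, r)) :
  row_mx u (row_mx v w) *m corner 1%:M = row_mx 0 (row_mx 0 w).
Proof.
by rewrite cornerE !mul_row_block !(mulmx0, add0r, addr0, mulmx1).
Qed.

(** Compression by the projector [corner 1%:M], stated as fixed-point
    equations so that factorisations through a corner matrix apply directly. *)
Lemma cornerP (M : 'M[C]_(p + (q + r))) :
  corner 1%:M *m M = M -> M *m corner 1%:M = M -> exists N, M = corner N.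
Proof.
move=> eM Me; exists (drsubmx (drsubmx M)); rewrite -{1}eM -{1}Me.
rewrite -{1}[M]submxK -{1}[drsubmx M]submxK !cornerE.
by do 2!rewrite !mulmx_block !(mul0mx, mulmx0, add0r, addr0, mul1mx, mulmx1).
Qed.
End Corner.

(** * The order in 3-by-3 block form *)

Section NormalForm.
Variables (C : numClosedFieldType) (p q r : nat).
Notation n := (p + (q + r))%N.
Implicit Types (X Y : 'M[C]_(p, n)) (Z : 'M[C]_(q, n)).

Lemma mul_col0_mx X (W : 'M[C]_(p, n)) :
  (col_mx X 0 : 'M_n) *m (col_mx W 0 : 'M_n) = col_mx (lsubmx X *m W) 0.
Proof.
by rewrite mul_col_mx mul0mx -{1}[X]hsubmxK mul_row_col mulmx0 addr0.
Qed.

(** Here a1 and b1 stand for the index-one parts in the adapted basis.  A row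
    (R S) times a1 is R X, so the first row of a1 a1 G = a1 reads T (X G) = X
    and the independence of the rows of X makes T invertible.  The second row
    of b1 a1 = a1 a1 is Z a1 = 0, which kills the first block of Z; then the
    second row of b1 b1 H = b1 makes T1 invertible in the same way.  Finally
    the first row of a1 b1 = a1 a1 is T Y + Sh1 Z = T X, with Sh1 the first
    block of Sh. *)
Lemma sharp_le_block_rows (T : 'M_p) (Sh : 'M_(p, q + r)) Y Z (G H : 'M[C]_n) :
  let X := row_mx T Sh in
  let a1 := col_mx X 0 : 'M_n in
  let b1 := col_mx Y (col_mx Z 0) : 'M_n in
  row_free X -> row_free Z ->
  a1 *m a1 *m G = a1 -> b1 *m b1 *m H = b1 ->
  b1 *m a1 = a1 *m a1 -> a1 *m b1 = a1 *m a1 ->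
  [/\ T \in unitmx, exists (T1 : 'M_q) (S1 : 'M_(q, r)), T1 \in unitmx /\
      Z = row_mx 0 (row_mx T1 S1) & Y = X - invmx T *m lsubmx Sh *m Z].
Proof.
move=> X a1 b1 fX fZ aa bb ba ab.
have Tu : T \in unitmx.
  move: aa; rewrite mul_col0_mx row_mxKl mul_col_mx => /eq_col_mx[] + _.
  by rewrite -mulmxA; apply: row_free_mull_unit.
move: ba; rewrite /b1 !mul_col_mx => /eq_col_mx[_].
rewrite !mul0mx -[0 in RHS](@col_mx0 _ q r) => /eq_col_mx[].
rewrite -{1}[Z]hsubmxK mul_row_col mulmx0 addr0 => /eqP.
rewrite mulmx_free_eq0 // => /eqP Z0 _.
have eZ : Z = row_mx 0 (row_mx (lsubmx (rsubmx Z)) (rsubmx (rsubmx Z))).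
  by rewrite hsubmxK -Z0 hsubmxK.
split=> //.
  exists (lsubmx (rsubmx Z)), (rsubmx (rsubmx Z)); split=> //.
  move: bb; rewrite -mulmxA {1}/b1 !mul_col_mx => /eq_col_mx[_ /eq_col_mx[+ _]].
  rewrite {1}eZ !mul_row_col !mul0mx mulmx0 add0r addr0.
  exact: row_free_mull_unit.
move: ab; rewrite !mul_col_mx !mul0mx => /eq_col_mx[+ _].
rewrite /a1 /b1 !mul_row_col mulmx0 addr0 -{1}[Sh]hsubmxK.
rewrite mul_row_col mulmx0 addr0.
move=> /(canRL (addrK _)) /(canRL (mulKmx Tu)) ->.
by rewrite mulmxBr mulKmx // mulmxA.
Qed.

Lemma block3_rows (T : 'M[C]_p) (S1 : 'M_(p, q)) S2
    (T1 : 'M_q) (S3 : 'M_(q, r)) :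
  block3_mx T S1 S2 0 T1 S3 0 0 0 =
  col_mx (row_mx T (row_mx S1 S2)) (col_mx (row_mx 0 (row_mx T1 S3)) 0).
Proof.
rewrite /block3_mx {1}/block_mx; congr col_mx.
rewrite [block_mx T1 _ _ _]/block_mx row_mx0 -block_mxEh.
by rewrite /block_mx row_mx0.
Qed.

(** Since b^* is block lower triangular with diagonal T^*, T1^*, 0, forward
    substitution in b^* M = 0 annihilates the first two block rows of M;
    M b = 0 does the same for its block columns. *)
Lemma orth_ker_corner (T : 'M_p) (T1 : 'M_q) S1 S2 S3 (M : 'M[C]_n) :
  T \in unitmx -> T1 \in unitmx ->
  let b := block3_mx T S1 S2 0 T1 S3 0 0 0 in
  b^t* *m M = 0 -> M *m b = 0 -> exists N, M = corner p q N.
Proof.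
move=> Tu T1u b oM Mo.
have Tu' : T^t* \in unitmx by rewrite map_unitmx unitmx_tr.
have T1u' : T1^t* \in unitmx by rewrite map_unitmx unitmx_tr.
apply: cornerP.
  move: oM; rewrite -[M]vsubmxK -[dsubmx M]vsubmxK corner1_mul.
  set u := usubmx M; set v := usubmx _; set w := dsubmx _.
  rewrite /b block3_rows !tr_col_mx !tr_row_mx !map_row_mx !map_col_mx.
  rewrite !trmx0 !map_mx0.
  rewrite !mul_row_col !mul_col_mx !mul0mx addr0 add_col_mx addr0 -col_mx0.
  move=> /eq_col_mx[/(congr1 (mulmx (invmx (T^t*))))].
  rewrite mulKmx // mulmx0 => ->.
  rewrite !mulmx0 col_mx0 add0r -col_mx0 => /eq_col_mx[].
  by move=> /(congr1 (mulmx (invmx (T1^t*)))); rewrite mulKmx // mulmx0 => ->.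
move: Mo; rewrite -[M]hsubmxK -[rsubmx M]hsubmxK mul_corner1.
set u := lsubmx M; set v := lsubmx _; set w := rsubmx _.
rewrite /b block3_rows !mul_row_col mulmx0 addr0 !mul_mx_row mulmx0 add_row_mx.
rewrite addr0 -row_mx0 => /eq_row_mx[/(congr1 (mulmxr (invmx T)))] /=.
rewrite mulmxK // mul0mx => ->.
rewrite !mul0mx row_mx0 add0r -row_mx0 => /eq_row_mx[].
by move=> /(congr1 (mulmxr (invmx T1))) /=; rewrite mulmxK // mul0mx => ->.
Qed.

Lemma corner_orth Y Z N : (col_mx Y (col_mx Z 0) : 'M_n)^t* *m corner p q N = 0.
Proof.
rewrite -[N]mul1mx -cornerM mulmxA !tr_col_mx !map_row_mx mul_corner1.
by rewrite trmx0 map_mx0 !row_mx0 mul0mx.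
Qed.

Lemma corner_ann Y Z (N : 'M[C]_r) :
  corner p q N *m (col_mx Y (col_mx Z 0) : 'M_n) = 0.
Proof.
by rewrite -[N]mulmx1 -cornerM -mulmxA corner1_mul !col_mx0 mulmx0.
Qed.

(** The nonzero rows of b^2 come from those of b by left multiplication with
    the invertible block matrix of rows (T, S1) and (0, T1); its inverse,
    completed by zeros, recovers b from b^2. *)
Lemma Ind_blocks (T : 'M[C]_p) (T1 : 'M_q) S1 S2 S3 :
  T \in unitmx -> T1 \in unitmx ->
  Ind (block3_mx T S1 S2 0 T1 S3 0 0 0 : 'M_n) = 1%N.
Proof.
move=> Tu T1u; rewrite block3_rows; set Y := row_mx T _; set Z := row_mx 0 _.
set b := col_mx Y _.
apply: (mull_Ind1 (X := block_mx (invmx T)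
  (row_mx (- (invmx T *m S1 *m invmx T1)) 0)
  0 (block_mx (invmx T1) 0 0 0))).
have -> : b *m b = col_mx (T *m Y + S1 *m Z) (col_mx (T1 *m Z) 0).
  rewrite {1}/b !mul_col_mx mul0mx /b !mul_row_col !mulmx0 !addr0 mul0mx.
  by rewrite add0r.
rewrite !mul_block_col mul_row_col !mul0mx !addr0 !add0r mulmxDr mulKmx //.
by rewrite mulKmx // mulNmx -!mulmxA mulKmx // addrK.
Qed.

(** With a, b the two matrices compared and x the group inverse of a, the
    formula for Y is exactly what makes X b = T X = X a, hence x b = x a, and
    a x = b x because a and b share the first block column (T, 0, 0). *)
Lemma sharp_le_blocks (T : 'M[C]_p) (T1 : 'M_q) Sh S1 :
  T \in unitmx -> T1 \in unitmx ->
  let X := row_mx T Sh in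
  let Z := row_mx 0 (row_mx T1 S1) in
  let Y := X - invmx T *m lsubmx Sh *m Z in
  sharp_le (col_mx X 0 : 'M_n) (col_mx Y (col_mx Z 0)).
Proof.
move=> Tu T1u X Z Y; set a := col_mx X 0 : 'M_n; set b := col_mx Y _ : 'M_n.
have aM W : a *m (col_mx W 0 : 'M_n) = col_mx (T *m W) 0.
  by rewrite mul_col0_mx row_mxKl.
have lY : lsubmx Y = T.
  by rewrite /Y /X /Z mul_mx_row mulmx0 opp_row_mx add_row_mx row_mxKl subr0.
have bM W : b *m (col_mx W 0 : 'M_n) = col_mx (T *m W) 0.
  rewrite /b !mul_col_mx mul0mx -[Y]hsubmxK lY !mul_row_col !mulmx0 mul0mx.
  by rewrite !addr0 col_mx0.
(* the group inverse of a *)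
pose x := col_mx (invmx T *m invmx T *m X) 0 : 'M_n.
have xM W : x *m (col_mx W 0 : 'M_n) = col_mx (invmx T *m W) 0.
  by rewrite mul_col0_mx -{1}[X]/(row_mx T Sh) mul_mx_row row_mxKl mulmxKV.
have Xa : X *m a = T *m X by rewrite mul_row_col mulmx0 addr0.
have Xb : X *m b = T *m X.
  rewrite /b mul_row_col -{1}[Sh]hsubmxK mul_row_col mulmx0 addr0 mulmxBr.
  by rewrite !mulmxA mulmxV // mul1mx subrK.
have xax : x *m (a *m a) = a by rewrite !(aM, xM) mulKmx.
split.
- exact: mull_Ind1 xax.
- rewrite /b -[Y]hsubmxK lY -[rsubmx Y]hsubmxK -block3_rows.
  exact: Ind_blocks.
have ax : a *m x = col_mx (invmx T *m X) 0 by rewrite aM -mulmxA mulKVmx.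
have xa : x *m a = col_mx (invmx T *m X) 0 by rewrite xM.
exists x; split; last 1 first.
- by rewrite /x !mul_col_mx !mul0mx -!mulmxA Xa Xb.
- split; first by rewrite expr2 -mulmxE.
    by rewrite -mulmxA ax xM mulmxA.
  by rewrite ax xa.
by rewrite ax bM -mulmxA mulKVmx.
Qed.

Lemma add_block3_corner (T : 'M[C]_p) (T1 : 'M_q) S1 S2 S3 (N : 'M_r) :
  block3_mx T S1 S2 0 T1 S3 0 0 N =
  block3_mx T S1 S2 0 T1 S3 0 0 0 + corner p q N.
Proof.
rewrite /corner /block3_mx !add_block_mx !add_row_mx !add_col_mx !addr0.
by rewrite add0r.
Qed.

Lemma CE_le_block (T : 'M[C]_p) (T1 : 'M_q) (N22 N2 : 'M_r) Sh1 Sh2 S1 :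
  T \in unitmx -> T1 \in unitmx ->
  nilpotent_mx N22 -> nilpotent_mx N2 -> minus_le N22 N2 ->
  CE_le (block3_mx T Sh1 Sh2 0 0 0 0 0 N22)
        (block3_mx T (Sh1 - invmx T *m Sh1 *m T1) (Sh2 - invmx T *m Sh1 *m S1)
                   0 T1 S1 0 0 N2).
Proof.
move=> Tu T1u nN22 nN2 le_N.
rewrite (add_block3_corner _ _ _ _ _ N22) (add_block3_corner _ _ _ _ _ N2).
rewrite !block3_rows.
have sh := sharp_le_blocks (row_mx Sh1 Sh2) S1 Tu T1u.
have eY : row_mx T (row_mx (Sh1 - invmx T *m Sh1 *m T1)
                           (Sh2 - invmx T *m Sh1 *m S1)) =
    row_mx T (row_mx Sh1 Sh2)
      - invmx T *m lsubmx (row_mx Sh1 Sh2) *m row_mx 0 (row_mx T1 S1).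
  by rewrite row_mxKl !mul_mx_row mulmx0 !opp_row_mx !add_row_mx subr0.
cbv zeta in sh; rewrite -eY in sh.
rewrite !row_mx0 col_mx0.
have core m (X : 'M[C]_(p, n)) (Z : 'M_(q, n)) (N : 'M_r) :
    m = col_mx X (col_mx Z 0) -> Ind m = 1%N -> nilpotent_mx N ->
    core_EP (m + corner p q N) m (corner p q N).
  move=> -> im nN; apply: core_EPI => //.
  - exact/nilpotent_corner.
  - exact: corner_orth.
  - exact: corner_ann.
have [ia ib _] := sh.
exists (col_mx (row_mx T (row_mx Sh1 Sh2)) 0), (corner p q N22).
eexists _, (corner p q N2); split; [| |exact: sh|exact/minus_le_corner].
- by apply: (core _ _ 0) => //; rewrite col_mx0.
- exact: core.
Qed.

(** This is the left-to-right implication once the adapted basis is chosen: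
    X row-free says that the first p basis vectors span the range of a1, and
    Z row-free that the range of b1 projects onto the next q coordinates. *)
Lemma CE_le_blockP (a b : 'M[C]_n) (X Y : 'M_(p, n)) (Z : 'M_(q, n)) a2 b2 :
  row_free X -> row_free Z ->
  let a1 := col_mx X 0 in let b1 := col_mx Y (col_mx Z 0) in
  core_EP a a1 a2 -> core_EP b b1 b2 -> sharp_le a1 b1 -> minus_le a2 b2 ->
  exists (T : 'M_p) (T1 : 'M_q) (N22 N2 : 'M_r) Sh1 Sh2 S1,
    (T \in unitmx /\ T1 \in unitmx) /\
    (nilpotent_mx N22 /\ nilpotent_mx N2 /\ minus_le N22 N2) /\
    a = block3_mx T Sh1 Sh2 0 0 0 0 0 N22 /\
    b = block3_mx T (Sh1 - invmx T *m Sh1 *m T1) (Sh2 - invmx T *m Sh1 *m S1)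
                  0 T1 S1 0 0 N2.
Proof.
move=> fX fZ a1 b1 [-> ia na oa ka] [-> ib nb ob kb].
move=> [_ _ [x [[xaa xax ax_xa] ax_bx xa_xb]]] le_ab.
have [H bbH] := Ind1_mulr ib.
rewrite expr2 -mulmxE in xaa.
have aax : a1 *m a1 *m x = a1 by rewrite -mulmxA ax_xa mulmxA ax_xa -mulmxA.
have ba : b1 *m a1 = a1 *m a1.
  by rewrite -{1}xaa (mulmxA b1) -ax_bx -(mulmxA a1 x) xaa.
have ab : a1 *m b1 = a1 *m a1.
  by rewrite -{1}aax -(mulmxA _ x) -xa_xb (mulmxA _ x) aax.
pose T := lsubmx X; pose Sh := rsubmx X.
have eX : X = row_mx T Sh by rewrite hsubmxK.
have [] := @sharp_le_block_rows T Sh Y Z x H; rewrite -?eX //.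
move=> Tu [T1 [S1 [T1u eZ]]] eY.
have eb : b1 = block3_mx T (lsubmx Sh - invmx T *m lsubmx Sh *m T1)
    (rsubmx Sh - invmx T *m lsubmx Sh *m S1) 0 T1 S1 0 0 0.
  rewrite block3_rows /b1 -eZ; congr (col_mx _ _).
  rewrite eY eZ {1}eX -{1}[Sh]hsubmxK !mul_mx_row mulmx0 !opp_row_mx.
  by rewrite !add_row_mx subr0.
have [N2 eb2] : exists N, b2 = corner p q N.
  by move: ob kb; rewrite eb; apply: orth_ker_corner.
have [N22 ea2] : exists N, a2 = corner p q N.
  have [[G eG] [G' eG']] := minus_le_mul le_ab.
  apply: cornerP; [rewrite eG'|rewrite eG]; rewrite eb2.
    by rewrite mulmxA cornerM mul1mx.
  by rewrite -mulmxA cornerM mulmx1.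
exists T, T1, N22, N2, (lsubmx Sh), (rsubmx Sh), S1; split=> //; split.
  split.
    by apply/(@nilpotent_corner _ p q); rewrite -ea2; eexists; apply: na.
  split.
    by apply/(@nilpotent_corner _ p q); rewrite -eb2; eexists; apply: nb.
  by apply/(minus_le_corner p q); rewrite -ea2 -eb2.
rewrite (add_block3_corner _ _ _ _ _ N22) (add_block3_corner _ _ _ _ _ N2).
rewrite -eb -eb2 -ea2; split=> //.
by rewrite block3_rows hsubmxK -eX !row_mx0 col_mx0.
Qed.

End NormalForm.

(** * Orthonormal bases adapted to nested ranges *)

Section Flag.
Variable C : numClosedFieldType.

Lemma unitary_col_mx n m1 m2 (P : 'M[C]_(m1, n)) (Q : 'M[C]_(m2, n)) :
  P \is unitarymx -> Q \is unitarymx -> P *m Q^t* = 0 ->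
  col_mx P Q \is unitarymx.
Proof.
move=> /unitarymxP uP /unitarymxP uQ PQ; apply/unitarymxP.
rewrite tr_col_mx map_row_mx mul_col_row uP uQ PQ.
have -> : Q *m P^t* = 0.
  by rewrite -[Q]trmxCK -map_mxM -trmx_mul PQ trmx0 map_mx0.
by rewrite -scalar_mx_block.
Qed.

Lemma orthonormal_basis n (V : 'M[C]_n) :
  exists2 Q : 'M[C]_(\rank V, n), Q \is unitarymx & (Q :=: V)%MS.
Proof.
exists (schmidt (row_base V)); first exact/schmidt_unitarymx/rank_leq_col.
exact: eqmx_trans (eqmx_schmidt_free (row_base_free V)) (eq_row_base V).
Qed.

Local Notation ortho V := (orthomx Num.conj (hermitian1mx _) V)%MS.

(** Gram-Schmidt applied separately to V, to the orthogonal complement of V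
    inside W, and to the orthogonal complement of W. *)
Lemma orthonormal_flag n (V W : 'M[C]_n) : (V <= W)%MS ->
  exists p q r (Q1 : 'M[C]_(p, n)) (Q2 : 'M[C]_(q, n)) (Q3 : 'M[C]_(r, n)),
    [/\ (p + (q + r) = n)%N, p = \rank V, (p + q)%N = \rank W,
        col_mx Q1 (col_mx Q2 Q3) \is unitarymx &
        [/\ V *m Q2^t* = 0, V *m Q3^t* = 0 & W *m Q3^t* = 0]].
Proof.
move=> VW.
have [Q1 u1 s1] := orthonormal_basis V.
have [Q2 u2 s2] := orthonormal_basis (W :&: ortho V)%MS.
have [Q3 u3 s3] := orthonormal_basis (ortho W).
have o2 : V *m Q2^t* = 0.
  by apply/orthomx1P; rewrite orthomx_sym s2 capmxSr.
have o3 : W *m Q3^t* = 0 by apply/orthomx1P; rewrite orthomx_sym s3.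
have o3' : V *m Q3^t* = 0.
  by case/submxP: VW => D ->; rewrite -mulmxA o3 mulmx0.
have rW : (\rank V + \rank (W :&: ortho V))%N = \rank W.
  rewrite -mxrank_disjoint_sum; last first.
    apply/eqP; rewrite -submx0 -(orthomx_ortho_disj V) sub_capmx capmxSl.
    exact: submx_trans (capmxSr _ _) (capmxSr _ _).
  rewrite capmxC (matrix_modl _ VW) (cap_eqmx (addsmx_ortho V) (eqmx_refl W)).
  by rewrite cap1mx.
exists _, _, _, Q1, Q2, Q3; split=> //.
  by rewrite addnA rW add_rank_ortho.
have sub0 m1 m2 m3 (D : 'M[C]_(m1, n)) (E : 'M[C]_(m2, n)) (Q : 'M[C]_(m3, n)) :
    (D <= E)%MS -> E *m Q^t* = 0 -> D *m Q^t* = 0.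
  by move=> /submxP[G ->] EQ; rewrite -mulmxA EQ mulmx0.
apply: unitary_col_mx => //.
  apply: unitary_col_mx => //; apply: sub0 o3.
  by rewrite s2 capmxSl.
rewrite tr_col_mx map_row_mx mul_mx_row.
by rewrite !(sub0 _ _ _ Q1 V) ?s1 // row_mx0.
Qed.

(** Ranges of M and N are row spaces of their adjoints, which is where the flag
    is built.  The dimensions p, q, r come with an equation and not as ranks, so
    that n can be replaced by their sum. *)
Lemma unitary_range_flag n (M N : 'M[C]_n) : (exists G, M = N *m G) ->
  exists (p q r : nat) (e : (p + (q + r) = n)%N) (U : 'M_n)
    (X Y : 'M[C]_(p, p + (q + r))) (Z : 'M[C]_(q, p + (q + r))),
    [/\ U \is unitarymx,
        M = uconj U (castmx (e, e) (col_mx X 0)),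
        N = uconj U (castmx (e, e) (col_mx Y (col_mx Z 0))),
        row_free X & row_free Z].
Proof.
case=> G MG; have sub : (M^t* <= N^t*)%MS.
  by rewrite MG trmx_mul map_mxM submxMl.
have [p [q [r [Q1 [Q2 [Q3 [e rM rN uQ [o2 o3 o3']]]]]]]] :=
  orthonormal_flag sub.
rewrite mxrank_map mxrank_tr in rM; rewrite mxrank_map mxrank_tr in rN.
have adj0 m (D : 'M_n) (Q : 'M_(m, n)) : D^t* *m Q^t* = 0 -> Q *m D = 0.
  by move=> h; rewrite -[Q *m D]trmxCK trmx_mul map_mxM h trmx0 map_mx0.
move: o2 o3 o3' => /adj0 o2 /adj0 o3 /adj0 o3'.
exists p, q, r, e.
case: n / e in M N G MG sub Q1 Q2 Q3 rM rN uQ adj0 o2 o3 o3' *.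
set Q := col_mx Q1 _ in uQ.
have uU : Q^t* \is unitarymx by rewrite trmxC_unitary.
have QM : Q *m M *m Q^t* = col_mx (Q1 *m M *m Q^t*) 0.
  by rewrite !mul_col_mx o2 o3 !mul0mx col_mx0.
have QN : Q *m N *m Q^t* =
    col_mx (Q1 *m N *m Q^t*) (col_mx (Q2 *m N *m Q^t*) 0).
  by rewrite !mul_col_mx o3' !mul0mx.
exists (Q^t*), (Q1 *m M *m Q^t*), (Q1 *m N *m Q^t*), (Q2 *m N *m Q^t*).
have rQ D : \rank (Q *m D *m Q^t*) = \rank D by rewrite (rank_uconj D uQ).
rewrite !castmx_id -QM -QN; split=> //.
- by rewrite -[M in LHS](uconjK M uQ).
- by rewrite -[N in LHS](uconjK N uQ).
- by rewrite /row_free -(rank_col_mx0 (q + r)) -QM rQ -rM.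
rewrite /row_free eqn_leq rank_leq_row -(leq_add2l p) rN -rQ QN -addsmxE.
apply: leq_trans (mxrank_adds_leqif _ _) _.
by rewrite rank_col_mx0 leq_add2r rank_leq_row.
Qed.
End Flag.

(** * Block characterisation of the C-E order *)

Theorem theorem4p4 (R : realType) (n : nat) (A B : 'M[R[i]]_n) :
  CE_le A B <->
  exists (U : 'M[R[i]]_n) (p q r : nat) (e : (p + (q + r) = n)%N)
         (T : 'M[R[i]]_p) (T1 : 'M[R[i]]_q) (N22 N2 : 'M[R[i]]_r)
         (Sh1 : 'M[R[i]]_(p, q)) (Sh2 : 'M[R[i]]_(p, r)) (S1 : 'M[R[i]]_(q, r)),
    U \is unitarymx /\
    (T \in unitmx /\ T1 \in unitmx) /\
    (nilpotent_mx N22 /\ nilpotent_mx N2 /\ minus_le N22 N2) /\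
    A = U *m castmx (e, e)
              (block3_mx T Sh1 Sh2
                         0 0   0
                         0 0   N22) *m U ^t* /\
    B = U *m castmx (e, e)
              (block3_mx
                 T (Sh1 - invmx T *m Sh1 *m T1) (Sh2 - invmx T *m Sh1 *m S1)
                 0 T1                           S1
                 0 0                            N2) *m U ^t*.
Proof.
split; last first.
  case=> U [p [q [r [e [T [T1 [N22 [N2 [Sh1 [Sh2 [S1 H]]]]]]]]]]].
  case: n / e in A B U H *; rewrite !castmx_id in H.
  case: H => uU [[Tu T1u] [[nN22 [nN2 le_N]] [-> ->]]].
  exact/(CE_le_uconj uU)/CE_le_block.
case=> A1 [A2 [B1 [B2 [cA cB sh le_AB]]]].
have rangeAB : exists G, A1 = B1 *m G.
  have [_ _ [x [[xAA _ Ax_xA] Ax_Bx _]]] := sh; exists (x *m A1).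
  by rewrite mulmxA -Ax_Bx Ax_xA -mulmxA mulmxE -expr2 -mulmxE.
have [p [q [r [e [U [X [Y [Z [uU eA1 eB1 fX fZ]]]]]]]]] :=
  unitary_range_flag rangeAB.
exists U, p, q, r, e.
case: n / e in A B A1 A2 B1 B2 U cA cB sh le_AB rangeAB uU eA1 eB1 *.
rewrite castmx_id in eA1; rewrite castmx_id in eB1.
have uV : U^t* \is unitarymx by rewrite trmxC_unitary.
move: cA cB sh le_AB; rewrite {}eA1 {}eB1.
move=> /(core_EP_uconj uV); rewrite uconjK // => cA.
move=> /(core_EP_uconj uV); rewrite uconjK // => cB.
move=> /(sharp_le_uconj uV); rewrite !uconjK // => sh.
move=> /(minus_le_uconj uV) le_AB.
have [T [T1 [N22 [N2 [Sh1 [Sh2 [S1 [units [nil [eA eB]]]]]]]]]] :=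
  CE_le_blockP fX fZ cA cB sh le_AB.
exists T, T1, N22, N2, Sh1, Sh2, S1; rewrite !castmx_id -eA -eB.
by split=> //; split=> //; split=> //; rewrite -!/(uconj U _) !uconjVK.
Qed.
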